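(* Let $\{Z_k: k=1,2, \ldots, n\}$ be an independent family of random variables, and let $H$ be a function that maps $n$ variables to $\mathcal{S}_d$. Let $\{A_k\}_{k=1}^n$ be a sequence of fixed matrices in $\mathcal{S}_d$ such that, for every $k$, $$\left(H\left(z_1, \ldots, z_k, \ldots, z_n\right)-H\left(z_1, \ldots, z_k^{\prime}, \ldots, z_n\right)\right)^2 \preceq A_k^2,$$ where $z_i$ and $z_i^{\prime}$ range over all possible values of $Z_i$ for each index $i$. Put $Z=(Z_1, \ldots, Z_n)$ and $\sigma^2:=\left\|\sum_k A_k^2\right\|$. Then, for all $t \geq 0$, $$\mathbb{P}\left\{\lambda_{\min }\left(H(Z)-\mathbb{E} H(Z)\right) \geq t\right\} \leq e^{-t^2 / (8 \sigma^2)}.$$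
   Context: $\mathcal{S}_d$ denotes the set of $d\times d$ real symmetric matrices. The Loewner order: for $A,B\in\mathcal{S}_d$, $A \preceq B$ means $B-A$ is positive semidefinite. $\|\cdot\|$ is the operator norm (largest singular value); $\lambda_{\min}$ denotes the smallest eigenvalue. Functions of random variables are understood to be measurable, and expectations of random matrices are entrywise. *)

(* Defs.v *)
From HB Require Import structures.
From mathcomp Require Import all_boot all_order all_algebra.
From mathcomp Require Import all_classical all_reals all_analysis.

Set Implicit Arguments.
Unset Strict Implicit.
Unset Printing Implicit Defensive.

Import Order.TTheory GRing.Theory Num.Theory.
Import numFieldNormedType.Exports.

Local Open Scope classical_set_scope.
Local Open Scope ring_scope.

Section matrices.
Context {R : realType} {m : nat}.
Implicit Types A B : 'M[R]_m.

Definition psdmx A : Prop :=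
  A \is symmetricmx /\ forall x : 'cV[R]_m, 0 <= (x^T *m A *m x) 0 0.

Definition loewner_le A B : Prop := psdmx (B - A).

(* The spectrum of a symmetric matrix of size m > 0 is finite and nonempty,
   so that the infimum below is a minimum. *)
Definition lambda_min A : R := inf [set a : R | eigenvalue A a].

Definition singular_values A : set R :=
  [set Num.sqrt a | a in [set a : R | eigenvalue (A^T *m A) a]].

Definition opnorm A : R := sup (singular_values A).

End matrices.

Section families.
Context {n : nat} {dT : 'I_n -> measure_display}.
Variable T : forall k, measurableType (dT k).

(* Product sigma-algebra: generated by the coordinate projections. *)
Definition prod_sigma_algebra : set (set (forall k, T k)) :=
  <<s \bigcup_k preimage_set_system setT (proj k) (@measurable _ (T k)) >>.

Definition measurable_entries (R : realType) (m : nat)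
    (H : (forall k, T k) -> 'M[R]_m) : Prop :=
  forall i j (B : set R), measurable B ->
    prod_sigma_algebra ((fun z => H z i j) @^-1` B).

End families.

Section probability.
Context {d : measure_display} {Omega : measurableType d} {R : realType}.
Variable P : probability Omega R.

Definition mutually_independent (n : nat) (dT : 'I_n -> measure_display)
    (T : forall k, measurableType (dT k))
    (Z : forall k, {RV P >-> T k}) : Prop :=
  forall (J : {set 'I_n}) (B : forall k, set (T k)),
    (forall k, measurable (B k)) ->
    P (\bigcap_(k in [set` J]) (Z k @^-1` B k)) =
      (\prod_(k in J) P (Z k @^-1` B k))%E.

(* fine discards an infinite entry, so the value is meaningful only when the
   entries of X are integrable (e.g. measurable and bounded). *)
Definition expectation_mx (m : nat) (X : Omega -> 'M[R]_m) : 'M[R]_m :=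
  \matrix_(i, j) fine ('E_P[fun w => X w i j])%E.

End probability.

(* Main.v *)
(** Since [lambda_min X <= X i i], it suffices to bound the upper tail of a
    single diagonal entry [f = H i i] of [H].  For symmetric [D] one has
    [(D i i)^2 <= (D^2) i i], so the hypothesis gives [f] bounded differences
    [c k] with [c k ^ 2 = (A k ^ 2) i i], whose sum over [k] is a diagonal
    entry of [\sum_k A k ^ 2] and hence at most [sigma^2].  A weak form of
    McDiarmid's inequality, with a moment generating function bounded by
    [exp (2 l^2 \sum_k (c k)^2)], then yields the claim.

    McDiarmid's inequality is obtained without conditional expectations:
    replacing the coordinate [Z k] by an independent copy does not change the
    law of [Z], so [E g(Z)] is the expectation of the average of [g] over its
    [k]-th coordinate.  Averaging out the coordinates one after another, each
    step costs a factor [exp (2 l^2 (c k)^2)]. *)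
Require Import Defs.
From HB Require Import structures.
From mathcomp Require Import all_boot all_order all_algebra.
From mathcomp Require Import ring lra.
From mathcomp Require Import all_classical all_reals all_analysis.
From mathcomp Require Import measurable_realfun.

Set Implicit Arguments.
Unset Strict Implicit.
Unset Printing Implicit Defensive.

Import Order.TTheory GRing.Theory Num.Theory.
Import numFieldNormedType.Exports.

Local Open Scope classical_set_scope.
Local Open Scope ring_scope.

(** * Quadratic forms of symmetric matrices *)

Lemma continuous_sum (R : realType) (T : topologicalType) (I : Type)
    (r : seq I) (F : I -> T -> R) :
  (forall i, continuous (F i)) -> continuous (fun x => \sum_(i <- r) F i x).
Proof.
move=> cF; apply: (@continuous_big R I +%R 0 xpredT) => [|i _].
  exact: add_continuous.
exact: cF.
Qed.

Section quadratic_form.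
Context {R : realType} {d : nat}.
Implicit Types (M N : 'M[R]_d) (u v : 'rV[R]_d).

Definition quad M v : R := (v *m M *m v^T) 0 0.

Lemma quadE M v : quad M v = \sum_j \sum_i v 0 i * M i j * v 0 j.
Proof.
rewrite /quad mxE; apply: eq_bigr => j _.
by rewrite !mxE mulr_suml.
Qed.

Lemma quadD M N v : quad (M + N) v = quad M v + quad N v.
Proof. by rewrite /quad mulmxDr mulmxDl mxE. Qed.

Lemma quad_sum (I : Type) (r : seq I) (F : I -> 'M[R]_d) v :
  quad (\sum_(i <- r) F i) v = \sum_(i <- r) quad (F i) v.
Proof. by rewrite /quad mulmx_sumr mulmx_suml summxE. Qed.

Lemma quadN M v : quad (- M) v = - quad M v.
Proof. by rewrite /quad mulmxN mulNmx mxE. Qed.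

Lemma quadZ M a v : quad M (a *: v) = a ^+ 2 * quad M v.
Proof.
by rewrite /quad linearZ/= -!scalemxAl -scalemxAr !mxE mulrA expr2.
Qed.

Lemma quad_scalar a v : quad a%:M v = a * quad 1%:M v.
Proof. by rewrite /quad mul_mx_scalar mulmx1 -scalemxAl mxE. Qed.

Lemma quad1E v : quad 1%:M v = \sum_i v 0 i ^+ 2.
Proof.
rewrite /quad mulmx1 mxE; apply: eq_bigr => i _.
by rewrite mxE expr2.
Qed.

Lemma quad1_ge0 v : 0 <= quad 1%:M v.
Proof. by rewrite quad1E sumr_ge0// => i _; exact: sqr_ge0. Qed.

Lemma quad1_gt0 v : v != 0 -> 0 < quad 1%:M v.
Proof.
move=> v0; rewrite lt_neqAle quad1_ge0 andbT eq_sym; apply: contra v0.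
rewrite quad1E psumr_eq0; last by move=> i _; exact: sqr_ge0.
move=> /allP v0; apply/eqP/rowP => i; rewrite mxE.
by have := v0 i (mem_index_enum _); rewrite sqrf_eq0 => /eqP.
Qed.

Lemma quad0 M : quad M 0 = 0.
Proof. by rewrite /quad !mul0mx mxE. Qed.

Lemma quad_delta M i : quad M (delta_mx 0 i) = M i i.
Proof. by rewrite /quad -rowE trmx_delta -colE !mxE. Qed.

Lemma quad_eigen M a v : v *m M = a *: v -> quad M v = a * quad 1%:M v.
Proof. by rewrite /quad => ->; rewrite mulmx1 -scalemxAl mxE. Qed.

Lemma quad_continuous M : continuous (quad M).
Proof.
have -> : quad M = fun v => \sum_j \sum_i v 0 i * M i j * v 0 j.
  by apply/funext => v; rewrite quadE.
have cv i : continuous (fun v : 'rV[R]_d => v 0 i) by exact: coord_continuous.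
refine (continuous_sum (fun j => continuous_sum (fun i v => _))).
exact: (cvgM (cvgM (cv i v) (cvg_cst _)) (cv j v)).
Qed.

Lemma symmetricmxE M : (M \is symmetricmx) = (M^T == M).
Proof. by rewrite is_hermitianmxE expr0 scale1r map_mx_id// eq_sym. Qed.

Lemma trmx_symmetric M : M \is symmetricmx -> M^T = M.
Proof.
by rewrite symmetricmxE => /eqP.
Qed.

Lemma quad_line M u v s : M \is symmetricmx ->
  quad M (u + s *: v) = quad M u + s * 2 * (u *m M *m v^T) 0 0
    + s ^+ 2 * quad M v.
Proof.
move=> Msym; have vMu : v *m M *m u^T = u *m M *m v^T.
  transitivity (u *m M *m v^T)^T; last first.
    by apply/matrixP => i j; rewrite !ord1 [LHS]mxE.
  by rewrite !trmx_mul trmxK trmx_symmetric// mulmxA.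
rewrite /quad linearD/= linearZ/= mulmxDl !mulmxDr !mulmxDl.
rewrite -!scalemxAl -!scalemxAr vMu.
move: (u *m M *m u^T) (u *m M *m v^T) (v *m M *m v^T) => a b c.
by rewrite !mxE; ring.
Qed.

(* If [quad M u = 0] for a positive semidefinite [M], then [0] minimises
   [s |-> quad M (u + s v)], so that its derivative [2 u M v^T] vanishes; take
   [v = u M]. *)
Lemma psd_quad_eq0 M u : M \is symmetricmx -> (forall v, 0 <= quad M v) ->
  quad M u = 0 -> u *m M = 0.
Proof.
move=> Msym M0 u0; set v := u *m M.
apply/eqP; apply: contraT => /quad1_gt0 v0.
set q := quad M v; have q0 : 0 <= q by exact: M0.
(* With [b] the squared length of [v], the form along the line is [2 s b + s^2 q]. Its minimiser
   [- b / q] is replaced by [- b / (q + 1)] because [q] may vanish; the value there is still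
   negative when [b > 0]. *)
have := M0 (u + (- quad 1%:M v / (q + 1)) *: v).
rewrite quad_line// u0 add0r -/v -/q.
have -> : (v *m v^T) 0 0 = quad 1%:M v by rewrite /quad mulmx1.
set b := quad 1%:M v in v0 *.
have -> : - b / (q + 1) * 2 * b + (- b / (q + 1)) ^+ 2 * q
  = - (b ^+ 2 * (q + 2)) / (q + 1) ^+ 2 by field; lra.
rewrite mulNr oppr_ge0 leNgt divr_gt0//; last by rewrite exprn_gt0//; lra.
by rewrite mulr_gt0// ?exprn_gt0//; lra.
Qed.

Lemma compact_sphere : compact [set v : 'rV[R]_d | quad 1%:M v = 1].
Proof.
apply: bounded_closed_compact.
  exists 1; split; first exact: num_real.
  (* The norm on row vectors is the maximum norm, and the square of each coordinate is at most the
     sum of all squares, which is 1 on the sphere. *)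
  move=> M M1 v /= v1; rewrite -[leLHS]/(mx_norm v) mx_normrE.
  apply: bigmax_le => [|[i j] _ /=]; first by lra.
  rewrite (ord1 i) (le_trans _ (ltW M1))// -(@expr_le1 _ 2)//.
  rewrite real_normK ?num_real// -v1 quad1E (bigD1 j)//= lerDl.
  by apply: sumr_ge0 => k _; exact: sqr_ge0.
apply: (@preimage_closed _ _ (quad 1%:M) [set 1]) => [v _|].
  exact: quad_continuous.
exact: closed_eq.
Qed.

(** The form attains its minimum over the compact unit sphere at some [c]. Subtracting [quad M c]
    times the identity leaves a positive semidefinite matrix whose form vanishes at [c], so
    [psd_quad_eq0] makes [c] an eigenvector. No spectral theorem is involved. *)
Lemma rayleigh_min M : (0 < d)%N -> M \is symmetricmx ->
  exists2 a, eigenvalue M a & forall v, a * quad 1%:M v <= quad M v.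
Proof.
move=> d0 Msym.
have [|c] := EVT_min_rV _ compact_sphere
    (continuous_subspaceT (@quad_continuous M)).
  exists (delta_mx 0 (Ordinal d0)); rewrite /= quad_delta mxE eqxx//.
rewrite inE/= => c1 cmin.
have Mmin v : quad M c * quad 1%:M v <= quad M v.
  have [->|v0] := eqVneq v 0; first by rewrite !quad0 mulr0.
  have v1 := quad1_gt0 v0.
  set s := Num.sqrt (quad 1%:M v).
  have s2 : s ^+ 2 = quad 1%:M v by rewrite sqr_sqrtr// ltW.
  have := cmin (s^-1 *: v); rewrite inE/= !quadZ exprVn s2 mulVf ?gt_eqF//.
  by move=> /(_ erefl); rewrite ler_pdivlMl// mulrC.
exists (quad M c) => //; apply/eigenvalueP; exists c; last first.
  apply/eqP => c0; move: c1; rewrite c0 quad0 => /esym/eqP.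
  by rewrite oner_eq0.
have Bsym : M - (quad M c)%:M \is symmetricmx.
  by rewrite symmetricmxE linearB/= tr_scalar_mx trmx_symmetric.
have : c *m (M - (quad M c)%:M) = 0.
  apply: psd_quad_eq0 => // [v|].
    by rewrite quadD quadN quad_scalar subr_ge0.
  by rewrite quadD quadN quad_scalar c1 mulr1 subrr.
by rewrite mulmxBr mul_mx_scalar => /eqP; rewrite subr_eq0 => /eqP.
Qed.

End quadratic_form.

(** * Extreme eigenvalues through Rayleigh quotients *)

Section lambda_min.
Context {R : realType} {d : nat}.
Hypothesis d_gt0 : (0 < d)%N.
Implicit Types M : 'M[R]_d.

Lemma rayleigh_max M : M \is symmetricmx ->
  exists2 a, eigenvalue M a & forall v, quad M v <= a * quad 1%:M v.
Proof.
move=> Msym; have NMsym : - M \is symmetricmx.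
  by rewrite symmetricmxE linearN/= trmx_symmetric.
have [a /eigenvalueP[v vM v0] aM] := rayleigh_min d_gt0 NMsym.
exists (- a) => [|u]; last by have := aM u; rewrite quadN mulNr lerNr.
by apply/eigenvalueP; exists v => //; rewrite scaleNr -vM mulmxN opprK.
Qed.

(** The Rayleigh minimum is itself an eigenvalue, and every eigenvalue is the Rayleigh quotient of
    its own eigenvector; hence the infimum in [lambda_min] is that minimum. *)
Lemma lambda_min_rayleigh M : M \is symmetricmx ->
  eigenvalue M (lambda_min M) /\
  forall v, lambda_min M * quad 1%:M v <= quad M v.
Proof.
move=> Msym; have [a aM amin] := rayleigh_min d_gt0 Msym.
suff -> : lambda_min M = a by [].
have alb : lbound [set b | eigenvalue M b] a.
  move=> b /eigenvalueP[v vM v0]; have := amin v.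
  by rewrite (quad_eigen vM) ler_pM2r// quad1_gt0.
apply/eqP; rewrite eq_le; apply/andP; split.
  by apply: ge_inf => //; exists a.
by apply: lb_le_inf => //; exists a.
Qed.

Lemma le_lambda_min M t : M \is symmetricmx ->
  t <= lambda_min M <-> forall v, t * quad 1%:M v <= quad M v.
Proof.
move=> /lambda_min_rayleigh[/eigenvalueP[u uM u0] Mmin]; split=> [tM v|].
  by apply: le_trans (Mmin v); rewrite ler_wpM2r// quad1_ge0.
by move=> /(_ u); rewrite (quad_eigen uM) ler_pM2r// quad1_gt0.
Qed.

(** A strict violation of the Rayleigh inequality persists on a neighbourhood, which contains a
    rational vector. Reducing to countably many test vectors serves to prove that the event of the
    theorem is measurable. *)
Lemma le_lambda_min_rat M t : M \is symmetricmx ->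
  t <= lambda_min M <->
  forall v : 'rV[rat]_d,
    t * quad 1%:M (map_mx ratr v) <= quad M (map_mx ratr v).
Proof.
move=> Msym; rewrite le_lambda_min//; split=> [tM v|tM v]; first exact: tM.
rewrite -subr_ge0 leNgt; apply/negP => /= vlt.
have : \forall u \near v, quad M u - t * quad 1%:M u < 0.
  suff cq : continuous (fun u => quad M u - t * quad 1%:M u).
    exact: (cq v _ (lt_nbhsl vlt)).
  move=> u; have cq N := @quad_continuous _ _ N u.
  exact: (cvgB (cq M) (cvgM (cvg_cst t) (cq 1%:M))).
move=> /nbhs_ballP[e /= e0 ve].
have /choice[q qv] i : exists q : rat, ratr q \in `]v 0 i - e, v 0 i + e[.
  by apply: rat_in_itvoo; lra.
suff : quad M (map_mx ratr (\row_i q i))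
    - t * quad 1%:M (map_mx ratr (\row_i q i)) < 0.
  by rewrite ltNge subr_ge0 tM.
apply: ve; split=> // i j; rewrite (ord1 i) !mxE /ball/=.
have := qv j; rewrite in_itv/= => /andP[qj1 qj2].
by rewrite ltr_distlC qj1 qj2.
Qed.

(** The diagonal entry is a Rayleigh quotient, hence at most the top eigenvalue [a]. Positivity
    gives [0 <= a], so [a] is the square root of the eigenvalue [a ^+ 2] of [M^T *m M], that is, a
    singular value. *)
Lemma diag_le_opnorm M i : M \is symmetricmx -> (forall v, 0 <= quad M v) ->
  M i i <= opnorm M.
Proof.
move=> Msym M0; have [a aM amax] := rayleigh_max Msym.
have a0 : 0 <= a.
  have /eigenvalueP[v vM v0] := aM.
  by have := M0 v; rewrite (quad_eigen vM) pmulr_lge0// quad1_gt0.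
apply: (@le_trans _ _ a).
  by have := amax (delta_mx 0 i); rewrite !quad_delta mxE eqxx mulr1.
have MMsym : M^T *m M \is symmetricmx.
  by rewrite symmetricmxE trmx_mul trmxK.
apply: ub_le_sup; last first.
  exists (a ^+ 2); last by rewrite sqrtr_sqr ger0_norm.
  have /eigenvalueP[v vM v0] := aM; apply/eigenvalueP; exists v => //.
  by rewrite trmx_symmetric// mulmxA vM -scalemxAl vM scalerA expr2.
(* The supremum bounds its elements only if the singular values are bounded above; the top
   eigenvalue of [M^T *m M] provides such a bound. *)
have [b _ bmax] := rayleigh_max MMsym.
exists (Num.sqrt b) => _ [c /eigenvalueP[v vc v0] <-].
rewrite ler_wsqrtr//.
by have := bmax v; rewrite (quad_eigen vc) ler_pM2r// quad1_gt0.
Qed.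

End lambda_min.

(** * A scalar inequality for exponential moments *)

(** For [x >= 1/2] one has [x <= 2 x^2]. Below [1/2], [expR x <= 1 / (1 - x) <= 1 + x + 2 x^2],
    since [(1 - x) (1 + x + 2 x^2) = 1 + x^2 (1 - 2 x)]. The linear term will integrate to zero for
    a centred variable. *)
Lemma expR_le_add_sqr (R : realType) (x : R) :
  expR x <= x + expR (2 * x ^+ 2).
Proof.
have [x2|x2] := leP 2^-1 x.
  have x0 : 0 <= x by apply: le_trans x2; rewrite invr_ge0.
  apply: (@le_trans _ _ (expR (2 * x ^+ 2))); last by rewrite lerDr.
  by rewrite ler_expR; nra.
apply: (@le_trans _ _ (x + (1 + 2 * x ^+ 2))); last first.
  by rewrite lerD2l expR_ge1Dx.
have x1 : 0 < 1 - x by lra.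
apply: (@le_trans _ _ (1 - x)^-1).
  rewrite -[x in expR x]opprK expRN lef_pV2 ?posrE ?expR_gt0//.
  exact: expR_ge1Dx.
by rewrite -div1r ler_pdivrMr//; nra.
Qed.

(** * Replacing one coordinate of a dependent tuple *)

Section dfwith_lemmas.
Context {I : eqType} {T : I -> Type}.
Implicit Types z : forall i, T i.

Lemma dfwithC z (j k : I) (x : T j) (y : T k) : j != k ->
  dfwith (dfwith z j x) k y = dfwith (dfwith z k y) j x.
Proof.
move=> jk; apply: functional_extensionality_dep => i.
have [ki|ki] := eqVneq k i.
  by subst i; rewrite dfwithin dfwithout// dfwithin.
rewrite dfwithout//; have [ji|ji] := eqVneq j i.
  by subst i; rewrite !dfwithin.
by rewrite !dfwithout.
Qed.

Lemma dfwith_idem z (k : I) (x y : T k) :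
  dfwith (dfwith z k x) k y = dfwith z k y.
Proof.
apply: functional_extensionality_dep => i.
have [ki|ki] := eqVneq k i; first by subst i; rewrite !dfwithin.
by rewrite !dfwithout.
Qed.

End dfwith_lemmas.

(** * Means and exponential moments of bounded random variables *)

Section probability_integral.
Context {d : measure_display} {Omega : measurableType d} {R : realType}.
Variable P : probability Omega R.

Lemma Rintegral_prob_cst (r : R) : \int[P]_w r = r.
Proof. by rewrite Rintegral_cst//= probability_setT/= mulr1. Qed.

Lemma integrable_cst_prob (r : R) : P.-integrable setT (EFin \o cst r).
Proof. exact: finite_measure_integrable_cst. Qed.

Lemma Rintegral_dist_le (X Y : Omega -> R) (c : R) :
  P.-integrable setT (EFin \o X) -> P.-integrable setT (EFin \o Y) ->
  (forall w, `|X w - Y w| <= c) -> `|\int[P]_w X w - \int[P]_w Y w| <= c.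
Proof.
suff le_add (U V : Omega -> R) : P.-integrable setT (EFin \o U) ->
    P.-integrable setT (EFin \o V) -> (forall w, `|U w - V w| <= c) ->
    \int[P]_w U w <= \int[P]_w V w + c.
  move=> iX iY XYc; rewrite ler_norml; apply/andP; split.
    rewrite lerBrDr addrC -lerBrDr opprK; apply: le_add => // w.
    by rewrite distrC.
  by rewrite lerBlDr addrC; exact: le_add.
move=> iU iV UVc; rewrite -[c](Rintegral_prob_cst c) -RintegralD//; last first.
  exact: integrable_cst_prob.
apply: le_Rintegral => //.
  exact: (integrableD measurableT iV (integrable_cst_prob c)).
by move=> w _; have := UVc w; rewrite ler_distlC; lra.
Qed.

End probability_integral.

Section bounded_random_variable.
Context {d : measure_display} {Omega : measurableType d} {R : realType}.
Variables (P : probability Omega R) (X : Omega -> R) (c : R).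
Hypothesis mX : measurable_fun setT X.
Hypothesis Xc : forall w w', `|X w - X w'| <= c.

Lemma integrable_bounded : P.-integrable setT (EFin \o X).
Proof.
apply: measurable_bounded_integrable => //.
  by rewrite [ltLHS]probability_setT ltry.
exists (c + `|X point|); split; first exact: num_real.
move=> M ltM w _ /=; rewrite (le_trans _ (ltW ltM))//.
by rewrite -[X w](subrK (X point)) (le_trans (ler_normD _ _))// lerD2r.
Qed.

Lemma dist_mean w : `|X w - \int[P]_w' X w'| <= c.
Proof.
rewrite -[X w](Rintegral_prob_cst P); apply: Rintegral_dist_le => //.
  exact: integrable_cst_prob.
exact: integrable_bounded.
Qed.

(** A Hoeffding-type bound with a weaker constant: [expR_le_add_sqr] is applied to [l * (X - m)],
    where [X] stays within [c] of its mean [m]. *)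
Lemma mgf_bounded (l : R) :
  (\int[P]_w (expR (l * X w))%:E <=
   (expR (l * \int[P]_w X w + 2 * l ^+ 2 * c ^+ 2))%:E)%E.
Proof.
set m := \int[P]_w X w.
set b := expR (2 * l ^+ 2 * c ^+ 2).
(* These are the coefficients of [expR (l * m) * (l * (X - m) + b)] as an affine function of [X]. It
   dominates [expR (l * X)] and has mean [expR (l * m) * b]. *)
pose p := expR (l * m) * l; pose q := expR (l * m) * (b - l * m).
have le_Y w : expR (l * X w) <= p * X w + q.
  have -> : p * X w + q = expR (l * m) * (l * (X w - m) + b).
    by rewrite /p /q; ring.
  rewrite -[l * X w](subrK (l * m)) addrC expRD ler_wpM2l ?expR_ge0//.
  rewrite -mulrBr (le_trans (expR_le_add_sqr _))// lerD2l ler_expR.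
  rewrite -mulrA ler_wpM2l// exprMn ler_wpM2l ?sqr_ge0//.
  rewrite -(real_normK (num_real (X w - m))) lerXn2r ?nnegrE ?dist_mean//.
  by rewrite (le_trans _ (dist_mean w)).
have iX := integrable_bounded.
have ipX : P.-integrable setT (EFin \o (fun w => p * X w)).
  exact: (integrableZl measurableT p iX).
have iY : P.-integrable setT (EFin \o (fun w => p * X w + q)).
  exact: (integrableD measurableT ipX (integrable_cst_prob P q)).
apply: (@le_trans _ _ (\int[P]_w (p * X w + q)%:E)%E).
  apply: ge0_le_integral => //.
  - apply/measurable_EFinP; apply: measurableT_comp => //.
    by apply: measurable_funM.
  - exact: measurable_int iY.
  - by move=> w _; rewrite lee_fin.
rewrite -[leLHS]fineK; last exact: (integrable_fin_num _ iY).
rewrite lee_fin -/(Rintegral _ _ _) RintegralD//; last first.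
  exact: integrable_cst_prob.
rewrite RintegralZl// Rintegral_prob_cst -/m expRD -/b /p /q.
by rewrite le_eqVlt; apply/orP; left; apply/eqP; ring.
Qed.

End bounded_random_variable.

(** * The product sigma-algebra and its generating boxes *)

Section product.
Context {n : nat} {dT : 'I_n -> measure_display}.
Variable T : forall k, measurableType (dT k).

Definition coord_preimages : set (set (forall k, T k)) :=
  \bigcup_k preimage_set_system setT (proj k) (@measurable _ (T k)).

(* A copy of the product type carrying the sigma-algebra
   [prod_sigma_algebra T]. *)
Definition prodT : Type := g_sigma_algebraType coord_preimages.
HB.instance Definition _ := Measurable.on prodT.

Lemma measurable_coord k : measurable_fun setT (fun z : prodT => z k).
Proof.
move=> _ B mB; rewrite setTI; apply: sub_sigma_algebra.
by exists k => //; exists B => //; rewrite setTI.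
Qed.

Lemma measurable_fun_prodT d (X : measurableType d) (f : X -> prodT) :
  (forall k, measurable_fun setT (fun x => f x k)) -> measurable_fun setT f.
Proof.
move=> mf; apply: (@measurability _ _ X prodT setT f coord_preimages) => //.
move=> _ [_ [k _ [B mB <-]] <-].
by rewrite [X in measurable (_ `&` _ @^-1` X)]setTI; exact: mf.
Qed.

Lemma measurable_dfwith k :
  measurable_fun setT (fun p : prodT * T k => dfwith p.1 k p.2 : prodT).
Proof.
apply: measurable_fun_prodT => i; have [ki|ki] := eqVneq k i.
  subst i; rewrite (_ : (fun _ => _) = snd); first exact: measurable_snd.
  by apply/funext => p; rewrite dfwithin.
rewrite (_ : (fun _ => _) = (fun p : prodT * T k => p.1 i)).
  exact: (measurableT_comp (@measurable_coord i) measurable_fst).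
by apply/funext => p; rewrite dfwithout.
Qed.

(** Coordinate preimages generate the sigma-algebra but need not be stable under intersection; boxes
    do both, as uniqueness of measures requires. *)
Definition boxes : set (set prodT) :=
  [set [set z : prodT | forall k, B k (z k)] |
     B in [set B : forall k, set (T k) | forall k, measurable (B k)]].

Lemma measurable_prodTE : @measurable _ prodT = <<s boxes >>.
Proof.
apply/seteqP; split.
  apply: smallest_sub => [|_ [k _ [B mB <-]]].
    exact: smallest_sigma_algebra.
  (* A coordinate preimage is the box whose other sides are full; conversely, a box is a finite
     intersection of coordinate preimages. *)
  apply: sub_sigma_algebra; exists (dfwith (fun i => setT : set (T i)) k B).
    move=> i; have [ki|ki] := eqVneq k i; first by subst i; rewrite dfwithin.
    by rewrite dfwithout.
  rewrite setTI; apply/seteqP; split => z /=.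
    by move/(_ k); rewrite dfwithin.
  move=> Bz i; have [ki|ki] := eqVneq k i; first by subst i; rewrite dfwithin.
  by rewrite dfwithout.
apply: smallest_sub => [|_ [B mB <-]]; first exact: sigma_algebra_measurable.
rewrite (_ : mkset _ = \bigcap_(k in setT) ((fun z : prodT => z k) @^-1` B k)).
  apply: fin_bigcap_measurable => // k _.
  by rewrite -[X in measurable X]setTI; exact: measurable_coord.
by apply/seteqP; split => z /= Bz k; [move=> _; exact: Bz|exact: (Bz k)].
Qed.

Lemma setI_closed_boxes : setI_closed boxes.
Proof.
move=> _ _ [A mA <-] [B mB <-]; exists (fun k => A k `&` B k).
  by move=> k; exact: measurableI.
apply/seteqP; split => z /=; first by move=> zAB; split=> k; have [] := zAB k.
by move=> [zA zB] k; split.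
Qed.

End product.

(** * Resampling and averaging one coordinate *)

Section resampling.
Context {d : measure_display} {Omega : measurableType d} {R : realType}.
Context {n : nat} {dT : 'I_n -> measure_display}.
Context {T : forall k, measurableType (dT k)}.
Variables (P : probability Omega R) (Z : forall k, {RV P >-> T k}).
Hypothesis Zind : mutually_independent Z.

Definition joint (w : Omega) : prodT T := fun k => Z k w.

Definition resample (k : 'I_n) (p : Omega * Omega) : prodT T :=
  dfwith (joint p.1) k (Z k p.2).

Lemma measurable_joint : measurable_fun setT joint.
Proof. by apply: measurable_fun_prodT => k; exact: measurable_funPT. Qed.

Lemma measurable_resample k : measurable_fun setT (resample k).
Proof.
have mp : measurable_fun setT (fun p : Omega * Omega => (joint p.1, Z k p.2)).
  apply: measurable_fun_pair.
    exact: (measurableT_comp measurable_joint measurable_fst).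
  exact: (measurableT_comp (measurable_funPT (Z k)) measurable_snd).
exact: (measurableT_comp (@measurable_dfwith _ _ T k) mp).
Qed.

(** It suffices to compare the two laws on boxes. Independence factors the probability of a box
    under [joint]; under [resample k] the factor of index [k] splits off by the product measure, and
    independence factors the rest. *)
Lemma resample_law k (A : set (prodT T)) : measurable A ->
  pushforward P joint A = pushforward (P \x P)%E (resample k) A.
Proof.
apply: (measure_unique (@boxes _ _ T) (fun=> setT)).
- exact: measurable_prodTE.
- exact: setI_closed_boxes.
- move=> _; exists (fun=> setT) => //.
  by apply/seteqP; split.
- exact: bigcup_const.
- exact: measurable_joint.
- exact: measurable_resample.
- move=> ? ? _ [B mB <-]; rewrite /= /pushforward.
  rewrite [X in P X](_ : _ =
      \bigcap_(i in [set` [set: 'I_n]%SET]) (Z i @^-1` B i)); last first.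
    apply/seteqP; split => w /= Bw i; first by move=> _; exact: Bw.
    by apply: Bw; rewrite /= inE.
  rewrite [X in (P \x P)%E X](_ : _ =
      (\bigcap_(i in [set` [set~ k]%SET]) (Z i @^-1` B i))
      `*` (Z k @^-1` B k)); last first.
    apply/seteqP; split => -[w w'] /=.
      move=> Bw; split; last by have := Bw k; rewrite /resample dfwithin.
      move=> i /=; rewrite !inE => ik.
      by have := Bw i; rewrite /resample dfwithout 1?eq_sym.
    move=> [Bw Bw'] i; rewrite /resample; have [ki|ki] := eqVneq k i.
      by subst i; rewrite dfwithin.
    by rewrite dfwithout//; apply: Bw; rewrite /= !inE eq_sym.
  have mZB i : measurable (Z i @^-1` B i).
    by rewrite -[X in measurable X]setTI; exact: measurable_funPT.
  rewrite [RHS]product_measure1E//; last first.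
    exact: fin_bigcap_measurable.
  rewrite Zind// (bigD1 k) ?inE//= muleC; congr (_ * _)%E.
  rewrite [RHS](Zind [set~ k]%SET mB).
  by apply: eq_bigl => i; rewrite !inE.
- by move=> ? _; rewrite /= /pushforward preimage_setT probability_setT ltry.
Qed.

Lemma integral_resample k (g : prodT T -> \bar R) : measurable_fun setT g ->
  (forall z, 0 <= g z)%E ->
  (\int[P]_w g (joint w) =
   \int[P]_w \int[P]_w' g (dfwith (joint w) k (Z k w')))%E.
Proof.
move=> mg g0.
have E1 := ge0_integral_pushforward measurable_joint P measurableT mg
  (fun z _ => g0 z).
have E2 := ge0_integral_pushforward (@measurable_resample k) (P \x P)%E
  measurableT mg (fun z _ => g0 z).
rewrite preimage_setT/= in E1; rewrite preimage_setT/= in E2.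
transitivity (\int[pushforward (P \x P) (resample k)]_y g y)%E.
  rewrite -[LHS]E1; apply: eq_measure_integral.
  - exact: measurable_resample.
  - exact: measurable_joint.
  - by move=> ? ? A mA _; exact: resample_law.
rewrite E2 fubini_tonelli1//.
exact: (measurableT_comp mg (@measurable_resample k)).
Qed.

(** Composed with [joint], this stands for the conditional expectation of [F] given all coordinates
    except the [k]-th. *)
Definition average (k : 'I_n) (F : prodT T -> R) (z : prodT T) : R :=
  \int[P]_w F (dfwith z k (Z k w)).

(** Points are restricted to the ranges of the [Z i], as in the hypothesis on [H]. *)
Definition bounded_diff (F : prodT T -> R) (c : 'I_n -> R) : Prop :=
  forall k (z : prodT T) (x : T k), (forall i, range (Z i) (z i)) ->
    range (Z k) x -> `|F z - F (dfwith z k x)| <= c k.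

Lemma range_joint w i : range (Z i) (joint w i).
Proof. by exists w. Qed.

Lemma range_dfwith (z : prodT T) (k : 'I_n) (x : T k) :
  (forall i, range (Z i) (z i)) -> range (Z k) x ->
  forall i, range (Z i) (dfwith z k x i).
Proof.
move=> zZ xZ i; have [ki|ki] := eqVneq k i; first by subst i; rewrite dfwithin.
by rewrite dfwithout.
Qed.

(** A hybrid argument: [mix s] takes the coordinates in [s] from [z'] and the others from [z].
    Adding an index [k] to [s] alters at most the [k]-th coordinate, at cost [c k]. *)
Lemma bounded_diff_dist F (c : 'I_n -> R) (z z' : prodT T) : bounded_diff F c ->
  (forall i, range (Z i) (z i)) -> (forall i, range (Z i) (z' i)) ->
  `|F z - F z'| <= \sum_k c k.
Proof.
move=> Fc zZ z'Z.
pose mix (s : seq 'I_n) : prodT T := fun i => if i \in s then z' i else z i.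
have -> : z' = mix (index_enum 'I_n).
  by apply: functional_extensionality_dep => i; rewrite /mix mem_index_enum.
elim: (index_enum _) => [|k s IHs].
  rewrite big_nil; have -> : mix [::] = z.
    exact: functional_extensionality_dep.
  by rewrite subrr normr0.
rewrite big_cons [leRHS]addrC -(subrK (F (mix s)) (F z)) -addrA.
rewrite (le_trans (ler_normD _ _))// lerD//.
have -> : mix (k :: s) = dfwith (mix s) k (z' k).
  apply: functional_extensionality_dep => i; rewrite /mix inE.
  have [->|ik] := eqVneq i k; first by rewrite dfwithin.
  by rewrite dfwithout 1?eq_sym.
by apply: Fc => // i; rewrite /mix; case: ifP.
Qed.

Section bounded_function.
Variables (F : prodT T -> R) (B : R).
Hypothesis mF : measurable_fun setT F.
Hypothesis F_bounds : forall z, 0 <= F z <= B.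

Lemma bounded_dist z z' : `|F z - F z'| <= B.
Proof.
have /andP[? ?] := F_bounds z; have /andP[? ?] := F_bounds z'.
by rewrite ler_norml; apply/andP; split; lra.
Qed.

Lemma measurable_slice (k : 'I_n) (z : prodT T) :
  measurable_fun setT (fun w => F (dfwith z k (Z k w))).
Proof.
have mp : measurable_fun setT (fun w : Omega => (z, Z k w)).
  by apply: measurable_fun_pair => //; exact: measurable_funPT.
apply: measurableT_comp mF _.
exact: (measurableT_comp (@measurable_dfwith _ _ T k) mp).
Qed.

(** The global bounds on [F] give integrability at every [z], also off the ranges, so that
    [average k F] is a genuine mean on the whole product. *)
Lemma integrable_slice (k : 'I_n) (z : prodT T) :
  P.-integrable setT (fun w => (F (dfwith z k (Z k w)))%:E).
Proof.
apply: (@integrable_bounded _ _ _ P _ B); first exact: measurable_slice.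
by move=> w w'; exact: bounded_dist.
Qed.

Lemma measurable_average k : measurable_fun setT (average k F).
Proof.
apply/measurable_EFinP.
pose f (p : prodT T * Omega) := (F (dfwith p.1 k (Z k p.2)))%:E.
have -> : EFin \o average k F = fubini_F P f.
  apply/funext => z; rewrite /= fineK//.
  exact: (integrable_fin_num _ (integrable_slice k z)).
apply: measurable_fun_fubini_tonelli_F; last first.
  by move=> p; rewrite lee_fin; case/andP : (F_bounds (dfwith p.1 k (Z k p.2))).
apply/measurable_EFinP; apply: measurableT_comp mF _.
have mp : measurable_fun setT
    (fun p : prodT T * Omega => (p.1, Z k p.2)).
  apply: measurable_fun_pair => //.
  exact: (measurableT_comp (measurable_funPT (Z k)) measurable_snd).
exact: (measurableT_comp (@measurable_dfwith _ _ T k) mp).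
Qed.

Lemma average_bounds k z : 0 <= average k F z <= B.
Proof.
apply/andP; split.
  by apply: Rintegral_ge0 => w _; case/andP : (F_bounds (dfwith z k (Z k w))).
rewrite -[leRHS](Rintegral_prob_cst P); apply: le_Rintegral => //.
- exact: integrable_slice.
- exact: integrable_cst_prob.
- by move=> w _; case/andP : (F_bounds (dfwith z k (Z k w))).
Qed.

(** The average no longer depends on its [k]-th coordinate. For [j != k] the two replacements
    commute, and the bound [c j], valid for each resampled value, passes to the mean. *)
Lemma bounded_diff_average c k : bounded_diff F c ->
  bounded_diff (average k F) (fun j => if j == k then 0 else c j).
Proof.
move=> Fc j z x zZ xZ; have [jk|jk] := eqVneq j k.
  subst k; rewrite /average.
  under [X in _ - X]eq_Rintegral => w _ do rewrite dfwith_idem.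
  by rewrite subrr normr0.
apply: Rintegral_dist_le => [||w]; [exact: integrable_slice..|].
rewrite dfwithC//; apply: Fc => //.
by apply: range_dfwith => //; exists w.
Qed.

End bounded_function.

Lemma Rintegral_average (F : prodT T -> R) (B : R) (k : 'I_n) :
  measurable_fun setT F ->
  (forall z, 0 <= F z <= B) ->
  \int[P]_w average k F (joint w) = \int[P]_w F (joint w).
Proof.
move=> mF F_bounds; rewrite /Rintegral; congr fine.
rewrite [RHS](@integral_resample k (EFin \o F))//=.
- apply: eq_integral => w _; rewrite fineK//.
  exact: (integrable_fin_num _ (integrable_slice mF F_bounds k _)).
- exact/measurable_EFinP.
- by move=> z; rewrite lee_fin; case/andP : (F_bounds z).
Qed.

(* [s] lists the coordinates that remain to be averaged out: off [s] the
   bounds vanish. *)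
Lemma mgf_bounded_diff (s : seq 'I_n) (F : prodT T -> R) c (B l : R) :
  measurable_fun setT F ->
  (forall z, 0 <= F z <= B) -> bounded_diff F c ->
  (forall k, k \notin s -> c k = 0) ->
  (\int[P]_w (expR (l * F (joint w)))%:E <=
   (expR (l * \int[P]_w F (joint w) + 2 * l ^+ 2 * \sum_k c k ^+ 2))%:E)%E.
Proof.
elim: s => [|k s IHs] in F c * => mF F_bounds Fc c0.
  (* With nothing left to average, all bounds vanish, so [F] is constant along [joint] and
     [mgf_bounded] applies with oscillation 0. *)
  have {}c0 k : c k = 0 by exact: c0.
  rewrite [X in _ + _ * X]big1 => [|k _]; last by rewrite c0 expr0n.
  have -> : 2 * l ^+ 2 * 0 = 2 * l ^+ 2 * 0 ^+ 2 :> R by rewrite expr0n.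
  apply: mgf_bounded; first exact: (measurableT_comp mF measurable_joint).
  move=> w w'; rewrite (le_trans (bounded_diff_dist Fc _ _))//.
  by rewrite big1.
pose c' j := if j == k then 0 else c j.
have IH : (\int[P]_w (expR (l * average k F (joint w)))%:E <=
    (expR (l * \int[P]_w F (joint w) + 2 * l ^+ 2 * \sum_j c' j ^+ 2))%:E)%E.
  rewrite -(Rintegral_average k mF F_bounds); apply: IHs.
  - exact: measurable_average.
  - exact: average_bounds.
  - exact: bounded_diff_average.
  - move=> j js; rewrite /c'; case: eqVneq => // jk.
    by apply: c0; rewrite inE negb_or jk.
have mexp (G : prodT T -> R) : measurable_fun setT G ->
    measurable_fun setT (fun z => (expR (l * G z))%:E).
  move=> mG; apply/measurable_EFinP; apply: measurableT_comp => //.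
  exact: measurable_funM.
rewrite (integral_resample k (mexp _ mF)); last first.
  by move=> z; rewrite lee_fin expR_ge0.
apply: (@le_trans _ _ (\int[P]_w ((expR (2 * l ^+ 2 * c k ^+ 2))%:E *
    (expR (l * average k F (joint w)))%:E))%E).
  apply: ge0_le_integral => //.
  - by move=> w _; apply: integral_ge0 => w' _; rewrite lee_fin expR_ge0.
  - apply: (@measurable_fun_fubini_tonelli_F _ _ _ _ _ P
      (fun p => (expR (l * F (resample k p)))%:E)); last first.
      by move=> p; rewrite lee_fin expR_ge0.
    exact: (measurableT_comp (mexp _ mF) (@measurable_resample k)).
  - apply: emeasurable_funM => //.
    apply: (measurableT_comp (mexp _ _) measurable_joint).
    exact: measurable_average.
  (* For fixed [w] only the resampled coordinate varies: the slice has mean [average k F (joint w)]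
     and oscillation at most [c k]. *)
  - move=> w _; rewrite -EFinM -expRD addrC; apply: mgf_bounded.
      exact: measurable_slice.
    move=> v v'.
    have := Fc k (resample k (w, v)) (Z k v').
    rewrite dfwith_idem; apply; last by exists v'.
    by apply: range_dfwith; [exact: range_joint|exists v].
rewrite ge0_integralZl_EFin ?expR_ge0//; last first.
  apply: (measurableT_comp (mexp _ _) measurable_joint).
  exact: measurable_average.
apply: (le_trans (lee_pmul _ _ (lexx _) IH)).
- by rewrite lee_fin expR_ge0.
- by apply: integral_ge0 => w _; rewrite lee_fin expR_ge0.
rewrite -EFinM -expRD lee_fin ler_expR (bigD1 k)//= [in leRHS](bigD1 k)//=.
rewrite /c' eqxx (eq_bigr (fun j => c j ^+ 2)) => [|j /negPf ->//].
by rewrite le_eqVlt; apply/orP; left; apply/eqP; ring.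
Qed.

(** * A weak McDiarmid inequality *)

Section concentration.
Variables (f : prodT T -> R) (c : 'I_n -> R).
Hypothesis mf : measurable_fun setT f.
Hypothesis fc : bounded_diff f c.

Lemma joint_dist w w' : `|f (joint w) - f (joint w')| <= \sum_k c k.
Proof. by apply: bounded_diff_dist => // i; exact: range_joint. Qed.

(* The differences of [f] are controlled only on the product of the ranges of
   the [Z k], outside of which [f] may be unbounded: hence the truncation. *)
Lemma mgf_joint (l : R) :
  (\int[P]_w (expR (l * f (joint w)))%:E <=
   (expR (l * \int[P]_w f (joint w) + 2 * l ^+ 2 * \sum_k c k ^+ 2))%:E)%E.
Proof.
(* On the product of the ranges [f] stays within [S] of [f (joint point)], hence in [[a, a + 2 S]].
   There [F] equals [f - a], while it lies in [[0, 2 S]] everywhere. *)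
pose S := \sum_k c k; pose a := f (joint point) - S.
pose F z := Num.min (Num.max (f z - a) 0) (2 * S).
have mfJ : measurable_fun setT (f \o joint).
  exact: measurableT_comp mf measurable_joint.
have FE (z : prodT T) : (forall i, range (Z i) (z i)) -> F z = f z - a.
  move=> zZ; have := bounded_diff_dist fc zZ (range_joint point).
  rewrite -/S ler_norml => /andP[fz1 fz2].
  by rewrite /F max_l ?min_l// /a; lra.
have S0 : 0 <= S by exact: le_trans (joint_dist point point).
have mF : measurable_fun setT F.
  apply: measurable_minr => //; apply: measurable_maxr => //.
  exact: measurable_funB.
have Fc : bounded_diff F c.
  move=> k z x zZ xZ; rewrite !FE//; last exact: range_dfwith.
  rewrite [X in `|X|](_ : _ = f z - f (dfwith z k x)); first exact: fc.
  by ring.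
have F_bounds z : 0 <= F z <= 2 * S.
  by rewrite /F le_min ge_min le_max !lexx !orbT/= mulr_ge0.
have FJ w : F (joint w) = f (joint w) - a.
  by rewrite FE// => i; exact: range_joint.
have IF : \int[P]_w F (joint w) = \int[P]_w f (joint w) - a.
  under eq_Rintegral do rewrite FJ.
  have iJ := integrable_bounded P mfJ joint_dist.
  rewrite (RintegralB measurableT iJ (integrable_cst_prob P a)).
  by rewrite Rintegral_prob_cst.
have c0 k : k \notin index_enum 'I_n -> c k = 0 by rewrite mem_index_enum.
have /= := mgf_bounded_diff l mF F_bounds Fc c0.
rewrite IF.
(* The shift by [a] multiplies both sides by [expR (- (l * a))], which is now cancelled. *)
under eq_integral do rewrite FJ mulrBr expRD EFinM muleC.
rewrite ge0_integralZl_EFin ?expR_ge0//; last first.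
  apply/measurable_EFinP; apply: measurableT_comp => //.
  exact: measurable_funM.
rewrite -lee_pdivlMl ?expR_gt0// -expRN -EFinM -expRD opprK => /le_trans; apply.
by rewrite lee_fin ler_expR le_eqVlt; apply/orP; left; apply/eqP; ring.
Qed.

(** Chernoff's bound leaves the exponent [- r t + 2 r^2 s], which is minimal at [r = t / (4 s)] with
    value [- t^2 / (8 s)]. *)
Lemma mcdiarmid (t s : R) : 0 < t -> 0 < s -> \sum_k c k ^+ 2 <= s ->
  (P [set w | (\int[P]_w' f (joint w') + t <= f (joint w))%R] <=
   (expR (- (t ^+ 2 / (8 * s))))%:E)%E.
Proof.
move=> t0 s0 cs.
have mfJ : measurable_fun setT (f \o joint).
  exact: measurableT_comp mf measurable_joint.
pose X_mixin := isMeasurableFun.Build _ _ _ _ _ mfJ.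
pose X : {RV P >-> R} := HB.pack (f \o joint) X_mixin.
set m := \int[P]_w' f (joint w'); pose r := t / (4 * s).
have r0 : 0 < r by rewrite divr_gt0//; lra.
apply: (le_trans (chernoff X (m + t) r0)).
have MX : ('M_P X r <= (expR (r * m + 2 * r ^+ 2 * s))%:E)%E.
  rewrite /mmt_gen_fun unlock; apply: le_trans (le_trans (mgf_joint r) _).
    rewrite le_eqVlt; apply/orP; left; apply/eqP; apply: eq_integral => w _.
    by rewrite /= mulrC.
  by rewrite lee_fin ler_expR lerD2l ler_wpM2l// mulr_ge0// sqr_ge0.
apply: (le_trans (lee_pmul _ _ MX (lexx _))).
- rewrite /mmt_gen_fun unlock; apply: integral_ge0 => w _.
  by rewrite lee_fin expR_ge0.
- by rewrite lee_fin expR_ge0.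
rewrite -EFinM -expRD lee_fin ler_expR le_eqVlt; apply/orP; left; apply/eqP.
by rewrite /r; field; lra.
Qed.

End concentration.

End resampling.

(** * Diagonal entries, squares and the Loewner order *)

Section matrix_entries.
Context {R : realType} {d : nat}.
Implicit Types M N : 'M[R]_d.

Lemma mx_sqrE M : M ^+ 2 = M *m M.
Proof. exact: expr2. Qed.

Lemma symmetric_entry M i j : M \is symmetricmx -> M i j = M j i.
Proof. by move=> /trmx_symmetric Msym; rewrite -[in LHS]Msym mxE. Qed.

Lemma symmetricB M N :
  M \is symmetricmx -> N \is symmetricmx -> M - N \is symmetricmx.
Proof.
by move=> Ms Ns; rewrite symmetricmxE linearB/= !trmx_symmetric.
Qed.

Lemma symmetric_sqr M : M \is symmetricmx -> M ^+ 2 \is symmetricmx.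
Proof.
by move=> Ms; rewrite symmetricmxE mx_sqrE trmx_mul trmx_symmetric.
Qed.

Lemma quad_sqr_ge0 M v : M \is symmetricmx -> 0 <= quad (M ^+ 2) v.
Proof.
move=> Ms; suff -> : quad (M ^+ 2) v = quad 1%:M (v *m M) by exact: quad1_ge0.
by rewrite /quad mulmx1 trmx_mul trmx_symmetric// mx_sqrE !mulmxA.
Qed.

(** By symmetry, the diagonal entry of the square is the sum of the squares of the entries in row
    [i]. *)
Lemma sqr_diag_le M i : M \is symmetricmx -> M i i ^+ 2 <= (M ^+ 2) i i.
Proof.
move=> Ms; rewrite mx_sqrE mxE (bigD1 i)//= expr2 lerDl.
apply: sumr_ge0 => j _.
by rewrite (symmetric_entry j i Ms) -expr2 sqr_ge0.
Qed.

Lemma loewner_le_diag M N i : loewner_le M N -> M i i <= N i i.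
Proof.
move=> [_ /(_ (delta_mx i 0))]; rewrite trmx_delta -rowE -colE !mxE.
by rewrite subr_ge0.
Qed.

Lemma diag_sqr_diff_le M N i : M \is symmetricmx -> N \is symmetricmx ->
  loewner_le (M ^+ 2) (N ^+ 2) -> `|M i i| <= Num.sqrt ((N ^+ 2) i i).
Proof.
move=> Ms Ns MN; rewrite -sqrtr_sqr ler_wsqrtr//.
exact: le_trans (sqr_diag_le i Ms) (loewner_le_diag i MN).
Qed.

Lemma lambda_min_le_diag M i : M \is symmetricmx -> lambda_min M <= M i i.
Proof.
move=> Ms; have d0 : (0 < d)%N by exact: leq_ltn_trans (ltn_ord i).
have [_ /(_ (delta_mx 0 i))] := lambda_min_rayleigh d0 Ms.
by rewrite !quad_delta mxE eqxx mulr1.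
Qed.

End matrix_entries.

(** By [le_lambda_min_rat] the event is a countable intersection of inequalities, each linear in the
    entries of [X]. *)
Lemma measurable_lambda_min_ge d0 (Omega : measurableType d0) (R : realType)
    (d : nat) (X : Omega -> 'M[R]_d) (t : R) :
  (0 < d)%N -> (forall i j, measurable_fun setT (fun w => X w i j)) ->
  (forall w, X w \is symmetricmx) ->
  measurable [set w | t <= lambda_min (X w)].
Proof.
move=> d_gt0 mX Xs.
rewrite (_ : mkset _ = \bigcap_(v in [set: 'rV[rat]_d])
    [set w | t * quad 1%:M (map_mx ratr v) <= quad (X w) (map_mx ratr v)]).
  rewrite -[X in measurable X]setCK setC_bigcap; apply: measurableC.
  apply: countable_bigcupT_measurable; first exact: countableP.
  move=> v; apply: measurableC.
  have mq : measurable_fun setT (fun w => quad (X w) (map_mx ratr v)).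
    have -> : (fun w => quad (X w) (map_mx ratr v)) = fun w =>
        \sum_j \sum_i (map_mx ratr v) 0 i * X w i j * (map_mx ratr v) 0 j.
      by apply/funext => w; rewrite quadE.
    apply: measurable_sum => j; apply: measurable_sum => i.
    by apply: measurable_funM => //; exact: measurable_funM.
  rewrite -[X in measurable X]setTI; apply: measurable_fun_le => //.
apply/seteqP; split => w /=.
  by move=> /(le_lambda_min_rat d_gt0 _ (Xs w)) tX v _; exact: tX.
by move=> tX; apply/(le_lambda_min_rat d_gt0 _ (Xs w)) => v; exact: tX.
Qed.

Theorem theorem2p15 (R : realType) (disp : measure_display)
    (Omega : measurableType disp) (P : probability Omega R)
    (n d : nat) (hd : (0 < d)%N)
    (dT : 'I_n -> measure_display) (T : forall k, measurableType (dT k))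
    (Z : forall k, {RV P >-> T k}) (hZ : mutually_independent Z)
    (H : (forall k, T k) -> 'M[R]_d)
    (Hsym : forall z, H z \is symmetricmx)
    (Hmeas : measurable_entries H)
    (A : 'I_n -> 'M[R]_d) (Asym : forall k, A k \is symmetricmx)
    (Hdiff : forall (k : 'I_n) (z : forall i, T i) (zk' : T k),
       (forall i, range (Z i) (z i)) -> range (Z k) zk' ->
       loewner_le ((H z - H (dfwith z k zk')) ^+ 2) (A k ^+ 2))
    (t : R) (ht : 0 <= t) :
  let HZ := fun w : Omega => H (fun k => Z k w) in
  let sigma2 := opnorm (\sum_k A k ^+ 2) in
  (P [set w | (t <= lambda_min (HZ w - expectation_mx P HZ))%R]
   <= expeR (- ((t ^+ 2)%:E / (8 * sigma2)%:E)))%E.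
Proof.
cbv zeta.
set HZ := fun w : Omega => H (fun k => Z k w).
set sigma2 := opnorm (\sum_k A k ^+ 2).
pose i0 := Ordinal hd.
pose f (z : prodT T) := H z i0 i0.
pose c k := Num.sqrt ((A k ^+ 2) i0 i0).
have mH i j : measurable_fun setT (fun z : prodT T => H z i j).
  by move=> _ B mB; rewrite setTI; exact: Hmeas.
have mf : measurable_fun setT f by exact: mH.
have mfJ : measurable_fun setT (f \o joint Z).
  exact: measurableT_comp mf (measurable_joint Z).
have fc : bounded_diff Z f c.
  move=> k z x zZ xZ.
  have -> : f z - f (dfwith z k x) = (H z - H (dfwith z k x)) i0 i0.
    by rewrite !mxE.
  apply: diag_sqr_diff_le => //; first exact: symmetricB.
  exact: Hdiff.
have c2 k : c k ^+ 2 = (A k ^+ 2) i0 i0.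
  by rewrite sqr_sqrtr// -quad_delta quad_sqr_ge0.
have c2_sigma2 : \sum_k c k ^+ 2 <= sigma2.
  under eq_bigr do rewrite c2.
  rewrite -summxE; apply: diag_le_opnorm => //.
    rewrite symmetricmxE raddf_sum/=; apply/eqP; apply: eq_bigr => k _.
    by rewrite trmx_symmetric// symmetric_sqr.
  move=> v; rewrite quad_sum; apply: sumr_ge0 => k _; exact: quad_sqr_ge0.
set M := expectation_mx P HZ.
have Ms : M \is symmetricmx.
  rewrite symmetricmxE; apply/eqP/matrixP => i j; rewrite !mxE.
  congr (fine ('E_P[_])).
  by apply/funext => w; exact: symmetric_entry (Hsym _).
have Mi0 : M i0 i0 = \int[P]_w f (joint Z w) by rewrite mxE unlock.
have HMs w : HZ w - M \is symmetricmx by exact: (symmetricB (Hsym _) Ms).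
have mE : measurable [set w | t <= lambda_min (HZ w - M)].
  apply: measurable_lambda_min_ge => // i j.
  have -> : (fun w => (HZ w - M) i j) = (fun w => HZ w i j - M i j).
    by apply/funext => w; rewrite !mxE.
  apply: measurable_funB => //.
  exact: (measurableT_comp (mH i j) (measurable_joint Z)).
have sub_f w : t <= lambda_min (HZ w - M) ->
    \int[P]_w f (joint Z w) + t <= f (joint Z w).
  move=> /le_trans/(_ (lambda_min_le_diag i0 (HMs w))).
  by rewrite !mxE -Mi0 lerBrDl mxE.
(* At [t = 0] the extended quotient is 0 even if [sigma2] vanishes, so the bound is 1. *)
have [t0|t_neq0] := eqVneq t 0.
  rewrite t0 expr0n/= mul0e oppe0 expeR0; apply: probability_le1.
  by rewrite -t0.
have t_gt0 : 0 < t by rewrite lt_neqAle eq_sym t_neq0.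
have [s_gt0|s_le0] := ltP 0 sigma2.
  rewrite inver ifF; last by apply/negbTE; lra.
  rewrite -EFinM -EFinN/=.
  apply: le_trans (mcdiarmid hZ mf fc t_gt0 s_gt0 c2_sigma2).
  apply: le_measure; rewrite ?inE//.
  by rewrite -[X in measurable X]setTI; exact: measurable_fun_le.
(* If [sigma2 <= 0], every [c k] vanishes and [f] equals its mean along [joint]. It cannot exceed
   that mean by [t > 0], so the event is empty, whatever the division by [sigma2] yields. *)
rewrite (_ : mkset _ = set0) ?measure0 ?expeR_ge0//.
apply/seteqP; split => // w /= /sub_f.
have c0 k : c k = 0.
  apply/eqP; rewrite -sqrf_eq0 eq_le sqr_ge0 andbT.
  apply: le_trans s_le0; apply: le_trans c2_sigma2.
  by rewrite (bigD1 k)//= lerDl sumr_ge0// => j _; exact: sqr_ge0.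
have := dist_mean P mfJ (joint_dist fc) w.
rewrite big1//= ler_norml => /andP[_ ?] ?; lra.
Qed.
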